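(* Let $\mathcal{G}=(V,F)$ be a pairwise factor graph with variable nodes $V=\{\mathsf{X}_1,\dots,\mathsf{X}_n\}$, with multilinear higher-order energies and strictly convex unary energies, that is, with total energy $$E(x_1,\dots,x_n)=\sum_{i}E_{\mathsf{X}_i}(x_i)+\sum_{f\in F}E_f(x_f),$$ $$E_{\mathsf{X}_i}(x_i)=-\langle b_{\mathsf{X}_i},x_i\rangle+\Psi_{\mathsf{X}_i}(x_i),\qquad E_f(x_f)=-\Big\langle W_f,\bigotimes_{\mathsf{X}_j\in f}x_j\Big\rangle,$$ where each $\Psi_{\mathsf{X}_i}$ is a strictly convex regularizer. Then the block coordinate descent updates which, given an order $\pi$, iteratively set $$x_{\pi_j}\leftarrow\operatorname*{argmin}_{x_{\pi_j}}E(x_1,\dots,x_n)$$ result in a chain of affine transformations (i.e., pre-activations) followed by non-linear activations, applied in the order $\pi$, yielding a traditional computation graph.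
   Context: A factor graph $\mathcal{G}=(V,F)$ is a bipartite graph with a set $V$ of variable nodes and a set $F\subseteq 2^V$ of factor nodes; each factor $f$ is linked to the variables it contains. It is pairwise if every factor contains two variables. Each variable node $\mathsf{X}_i$ is associated with a representation vector $x_i\in\mathbb{R}^{d_i}$, and $x_f$ denotes the values of all variables linked to the factor $f$. Here $b_{\mathsf{X}_i}\in\mathbb{R}^{d_i}$ is a parameter vector, $W_f$ is a parameter tensor of matching dimension, $\otimes$ is the outer product and $\langle\cdot,\cdot\rangle$ is the Frobenius inner product. For a pairwise factor $f=\{\mathsf{X},\mathsf{Y}\}$ the factor energy is bilinear and can be written $E_f(x,y)=-x^\top W_f y$. In each update, the block $x_{\pi_j}$ is minimized over while all other blocks are held fixed at their current values. Regularizers may include indicator functions of sets ($0$ on the set, $+\infty$ off it). The Fenchel conjugate of $\Psi$ is $\Psi^*(t)=\sup_{x\in\mathbb{R}^d}\langle x,t\rangle-\Psi(x)$. Standing convention: when $\Psi$ is strictly convex, $\Psi^*$ is differentiable and $(\nabla\Psi^* )(t)$ is the unique maximizer $\operatorname{argmax}_{x\in\mathbb{R}^d}\langle x,t\rangle-\Psi(x)$. The activation meant for the variable $\mathsf{X}_i$ is the map $\nabla\Psi_{\mathsf{X}_i}^*$ (for example, $\Psi(h)=\frac12\|h\|^2+\iota_{\mathbb{R}_+}(h)$, with $\iota$ the indicator function, gives relu). ''Non-linear activation'' is used as the generic neural-network term: the maps $\nabla\Psi^*$ are generally non-linear, and the choice $\Psi(h)=\frac12\|h\|^2$, whose associated map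 is the identity, is also among the listed examples. A traditional computation graph means the directed graph of a feed-forward computation, obtained here by unrolling the updates. *)

(* Defs.v *)
From HB Require Import structures.
From mathcomp Require Import all_boot all_order all_algebra.
From mathcomp Require Import all_classical all_reals all_analysis.

Set Implicit Arguments.
Unset Strict Implicit.
Unset Printing Implicit Defensive.

Import Order.TTheory GRing.Theory Num.Theory.
Import numFieldNormedType.Exports.
Local Open Scope classical_set_scope.
Local Open Scope ring_scope.

(* Vectors of R^d are row vectors, so x^T W y is written x *m W *m y^T. *)

Section Convex.
Variables (R : realType) (d : nat).
Implicit Types (Psi : 'rV[R]_d -> \bar R) (t x y : 'rV[R]_d).

Definition dotv x y : R := \sum_(k < d) x 0 k * y 0 k.

(* Regularizers take values in ]-oo, +oo]; the inequality is only required on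
   the effective domain, outside of which the right-hand side is +oo. *)
Definition strictly_convex Psi : Prop :=
  (forall x, Psi x != -oo%E) /\
  (forall x y (a : R), x != y -> (Psi x < +oo)%E -> (Psi y < +oo)%E ->
     0 < a < 1 ->
     (Psi (a *: x + (1 - a) *: y)%R < a%:E * Psi x + (1 - a)%R%:E * Psi y)%E).

Definition fenchel_conj Psi t : \bar R :=
  ereal_sup (range (fun x => ((dotv x t)%:E - Psi x)%E)).

Definition argmin (f : 'rV[R]_d -> \bar R) : set 'rV[R]_d :=
  [set x | forall y, (f x <= f y)%E].

Definition argmax (f : 'rV[R]_d -> \bar R) : set 'rV[R]_d :=
  [set x | forall y, (f y <= f x)%E].

Definition gradient (f : 'rV[R]_d -> R) t : 'rV[R]_d :=
  \row_(k < d) 'D_(delta_mx 0 k) f t.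

Definition grad_conj Psi : 'rV[R]_d -> 'rV[R]_d :=
  gradient (fun t => fine (fenchel_conj Psi t)).

(* The conjugate of the regularizer is real-valued and (Frechet)
   differentiable, and the supremum defining it is attained.  Strict convexity
   alone does not give this (take exp on the real line).  That the maximizer is
   unique and equal to [grad_conj Psi t] is not assumed: it follows. *)
Definition smooth_conj Psi : Prop :=
  forall t, [/\ fenchel_conj Psi t \is a fin_num,
                differentiable (fun s => fine (fenchel_conj Psi s)) t
              & argmax (fun x => ((dotv x t)%:E - Psi x)%E) !=set0].

End Convex.

Section Tensor.
Variables (R : realType) (n : nat) (d : 'I_n -> nat).

Definition multi_index (f : {set 'I_n}) :=
  {dffun forall k : {k : 'I_n | k \in f}, 'I_(d (val k))}.

(* Tensors with one axis of size [d k] for each variable [k] of [f]. *)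
Definition tensor (f : {set 'I_n}) := {ffun multi_index f -> R}.

Definition outer (f : {set 'I_n}) (x : forall i, 'rV[R]_(d i)) : tensor f :=
  [ffun m : multi_index f => \prod_k x (val k) 0 (m k)].

Definition frobenius (f : {set 'I_n}) (A B : tensor f) : R :=
  \sum_(m : multi_index f) A m * B m.

End Tensor.

(* Variable nodes are 'I_nvar, factors are sets of variable nodes. The tensor
   [weight f] is only used when [f \in factors]. *)
Record factor_model (R : realType) := FactorModel {
  nvar : nat;
  vdim : 'I_nvar -> nat;
  factors : {set {set 'I_nvar}};
  bias : forall i, 'rV[R]_(vdim i);
  weight : forall f, tensor R vdim f;
  reg : forall i, 'rV[R]_(vdim i) -> \bar R }.

Section Model.
Variables (R : realType) (M : factor_model R).

Definition pairwise_model : Prop := forall f, f \in factors M -> #|f| = 2%N.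

Definition state := forall i : 'I_(nvar M), 'rV[R]_(vdim i).

Definition unary_energy (i : 'I_(nvar M)) (z : 'rV[R]_(vdim i)) : \bar R :=
  ((- dotv (bias i) z)%R%:E + reg z)%E.

Definition factor_energy (f : {set 'I_(nvar M)}) (x : state) : R :=
  - frobenius (weight f) (outer f x).

Definition energy (x : state) : \bar R :=
  (\sum_i unary_energy (x i)
   + \sum_(f in factors M) (factor_energy f x)%:E)%E.

Definition bcd_step (j : 'I_(nvar M)) (x x' : state) : Prop :=
  (forall i, i != j -> x' i = x i) /\
  argmin (fun z : 'rV[R]_(vdim j) => energy (dfwith x j z)) (x' j).

(* The matrix W_f of the bilinear energy - x^T W_f y of f = {i, j}, with rows
   indexed by the coordinates of i and columns by those of j. For i != j the sum
   has exactly one term, the one at the multi-index i |-> a, j |-> b. *)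
Definition weight_mx (i j : 'I_(nvar M)) : 'M[R]_(vdim i, vdim j) :=
  \matrix_(a, b)
    \sum_(m : multi_index (@vdim R M) [set i; j]%SET
            | [forall k, ((val k == i) ==> (m k == a :> nat)) &&
                         ((val k == j) ==> (m k == b :> nat))])
       weight [set i; j]%SET m.

Definition preactivation (j : 'I_(nvar M)) (x : state) : 'rV[R]_(vdim j) :=
  bias j + \sum_(i | [set i; j]%SET \in factors M) x i *m weight_mx i j.

Definition activation (j : 'I_(nvar M)) : 'rV[R]_(vdim j) -> 'rV[R]_(vdim j) :=
  grad_conj (@reg R M j).

End Model.

(* [input] nodes carry given values; every other node applies [cact] to an
   affine function of the values of its predecessors. *)
Record compgraph (R : realType) := CompGraph {
  node : finType;
  ndim : node -> nat;
  arrow : rel node;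
  input : pred node;
  cbias : forall v, 'rV[R]_(ndim v);
  cweight : forall u v, 'M[R]_(ndim u, ndim v);
  cact : forall v, 'rV[R]_(ndim v) -> 'rV[R]_(ndim v) }.

Section CompGraph.
Variables (R : realType) (C : compgraph R).

Definition feedforward : Prop :=
  (forall u v : node C, arrow u v -> ~~ connect (@arrow R C) v u) /\
  (forall u v : node C, arrow u v -> ~~ input v).

Definition forward_eval (h : forall v : node C, 'rV[R]_(ndim v)) : Prop :=
  forall v : node C, ~~ input v ->
    h v = cact (cbias v + \sum_(u | arrow u v) h u *m cweight u v).

End CompGraph.

Section Unroll.
Variables (R : realType) (M : factor_model R).
(* The order: the k-th update is that of block [pi k]. It is not required to be
   a permutation, so several sweeps, or blocks never updated, are allowed. *)
Variables (N : nat) (pi : 'I_N -> 'I_(nvar M)).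

(* [X k] is the state before the k-th update; only [X 0], ..., [X N] matter. *)
Definition bcd_run (X : nat -> state M) : Prop :=
  forall k : 'I_N, bcd_step (pi k) (X k) (X k.+1).

(* The blocks held fixed in the first update lie in the domain of their
   regularizers; otherwise the energy is constantly +oo along the updated block
   and its argmin is the whole space. The block updated first is unconstrained
   since its initial value is never used. *)
Definition feasible (x : state M) : Prop :=
  forall i, (forall k : 'I_N, k = 0%N :> nat -> pi k != i) ->
    (reg (x i) < +oo)%E.

(* Nodes of the unrolled graph: [inl i] is the initial value of block i and
   [inr k] is the value computed by the k-th update. *)
Definition block_of (v : 'I_(nvar M) + 'I_N) : 'I_(nvar M) :=
  match v with inl i => i | inr k => pi k end.

(* [current u k]: [u] carries the value of its block just before update k. *)
Definition current (u : 'I_(nvar M) + 'I_N) (k : 'I_N) : bool :=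
  match u with
  | inl i => [forall l : 'I_N, (l < k)%N ==> (pi l != i)]
  | inr l => (l < k)%N &&
             [forall l' : 'I_N, (l < l' < k)%N ==> (pi l' != pi l)]
  end.

Definition unroll_arrow : rel ('I_(nvar M) + 'I_N)%type := fun u v =>
  match v with
  | inl _ => false
  | inr k => current u k && ([set block_of u; pi k]%SET \in factors M)
  end.

Definition unroll : compgraph R :=
  @CompGraph R ('I_(nvar M) + 'I_N)%type
    (fun v => vdim (block_of v))
    unroll_arrow
    (fun v => if v is inl _ then true else false)
    (fun v => bias (block_of v))
    (fun u v => weight_mx (block_of u) (block_of v))
    (fun v => @activation R M (block_of v)).

Definition run_val (X : nat -> state M) (v : node unroll) : 'rV[R]_(ndim v) :=
  match v return 'rV[R]_(vdim (block_of v)) with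
  | inl i => X 0%N i
  | inr k => X k.+1 (pi k)
  end.

End Unroll.

Arguments run_val {R M N} pi X v.

(* Main.v *)
Require Import Defs.
From HB Require Import structures.
From mathcomp Require Import all_boot all_order all_algebra.
From mathcomp Require Import all_classical all_reals all_analysis.

Set Implicit Arguments.
Unset Strict Implicit.
Unset Printing Implicit Defensive.

Import Order.TTheory GRing.Theory Num.Theory.
Import numFieldNormedType.Exports.
Local Open Scope classical_set_scope.
Local Open Scope ring_scope.

(* As a function of a single block z = x_j, the energy is a constant plus
   Psi_j(z) - <z, a_j(x)>, where the pre-activation a_j(x) collects the bias and
   the bilinear terms of the factors through j and is affine in the neighbours
   of j. A minimizer over z is thus a maximizer of <z, a_j(x)> - Psi_j(z), that
   is, grad Psi_j^* at a_j(x). In the unrolled graph each neighbour is read at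
   its most recent update, the unique [current] node of its block. *)

(** * Fenchel conjugates and their maximizers *)

Section Conjugate.
Variables (R : realType) (d : nat).
Implicit Types (Psi : 'rV[R]_d -> \bar R) (t x y z : 'rV[R]_d).

Lemma dotvE x y : dotv x y = (x *m y^T) 0 0.
Proof. by rewrite mxE; apply: eq_bigr => k _; rewrite !mxE. Qed.

Lemma dotvC x y : dotv x y = dotv y x.
Proof. by apply: eq_bigr => k _; rewrite mulrC. Qed.

Lemma dotvDr x y z : dotv x (y + z) = dotv x y + dotv x z.
Proof. by rewrite !dotvE linearD /= mulmxDr mxE. Qed.

Lemma dotvZr a x y : dotv x (a *: y) = a * dotv x y.
Proof. by rewrite !dotvE linearZ /= -scalemxAr mxE. Qed.

Lemma dotv_sumr (I : finType) (P : pred I) x (F : I -> 'rV[R]_d) :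
  dotv x (\sum_(i | P i) F i) = \sum_(i | P i) dotv x (F i).
Proof.
rewrite dotvE linear_sum /= mulmx_sumr summxE.
by apply: eq_bigr => i _; rewrite dotvE.
Qed.

Lemma dotv_delta x k : dotv x (delta_mx 0 k) = x 0 k.
Proof.
rewrite /dotv (bigD1 k) //= big1 ?addr0 => [|l /negbTE lk].
  by rewrite mxE !eqxx mulr1.
by rewrite mxE eqxx lk mulr0.
Qed.

Lemma fenchel_conj_ge Psi t x :
  ((dotv x t)%:E - Psi x <= fenchel_conj Psi t)%E.
Proof. by apply: ereal_sup_ubound; exists x. Qed.

Lemma fenchel_conj_argmax Psi t x :
  argmax (fun x => ((dotv x t)%:E - Psi x)%E) x ->
  fenchel_conj Psi t = ((dotv x t)%:E - Psi x)%E.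
Proof.
move=> xmax; apply/eqP; rewrite eq_le fenchel_conj_ge andbT.
by apply: ge_ereal_sup => _ [y _ <-]; exact: xmax.
Qed.

(** At a maximizer the supremum is the finite number [dotv x t - Psi x], which forces [Psi x] itself
    to be finite. *)
Lemma argmax_fin_num Psi t x : smooth_conj Psi ->
  argmax (fun x => ((dotv x t)%:E - Psi x)%E) x -> Psi x \is a fin_num.
Proof.
move=> /(_ t)[+ _ _] xmax; rewrite (fenchel_conj_argmax xmax).
by case: (Psi x).
Qed.

(* [x] is a subgradient of the conjugate at [t], so the difference quotients
   along a coordinate vector are at least [x 0 k] on the right and at most
   [x 0 k] on the left; differentiability squeezes the derivative to [x 0 k]. *)
Lemma grad_conj_argmax Psi t x : smooth_conj Psi ->
  argmax (fun x => ((dotv x t)%:E - Psi x)%E) x -> grad_conj Psi t = x.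
Proof.
move=> sPsi xmax; pose f s := fine (fenchel_conj Psi s).
have fE s : (f s)%:E = fenchel_conj Psi s by rewrite fineK//; have [] := sPsi s.
have subg v : dotv x v <= f (v + t) - f t.
  rewrite lerBrDr -lee_fin EFinD !fE (fenchel_conj_argmax xmax) addeA -EFinD.
  by rewrite -dotvDr; exact: fenchel_conj_ge.
apply/rowP => k; rewrite mxE -[RHS]dotv_delta.
set e := delta_mx 0 k.
have [_ /(@diff_derivable _ _ _ _ _ e) fdrv _] := sPsi t.
rewrite -/f in fdrv *.
apply/eqP; rewrite eq_le; apply/andP; split.
- rewrite /derive cvg_at_leftE//; apply: limr_le.
    by apply/cvg_ex; exists ('D_e f t); exact: cvg_dnbhs_at_left.
  near=> h; have h0 : h < 0 by near: h; exact: nbhs_left_lt.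
  rewrite /= [_ *: _]mulrC ler_ndivrMr// mulrC -dotvZr.
  exact: subg.
- rewrite /derive cvg_at_rightE//; apply: limr_ge.
    by apply/cvg_ex; exists ('D_e f t); exact: cvg_dnbhs_at_right.
  near=> h; have h0 : 0 < h by near: h; exact: nbhs_right_gt.
  rewrite /= [_ *: _]mulrC ler_pdivlMr// mulrC -dotvZr.
  exact: subg.
Unshelve. all: by end_near. Qed.

Lemma argmax_grad_conj Psi t : smooth_conj Psi ->
  argmax (fun x => ((dotv x t)%:E - Psi x)%E) (grad_conj Psi t).
Proof.
by move=> sPsi; have [_ _ [x xmax]] := sPsi t; rewrite (grad_conj_argmax sPsi xmax).
Qed.

End Conjugate.

(** * The energy as a function of one block *)

Section Energy.
Variables (R : realType) (M : factor_model R).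
Implicit Types (x : state M) (i j : 'I_(nvar M)) (f : {set 'I_(nvar M)}).

(** A multi-index over a pair amounts to its two entries, so the contraction with the tensor
    regroups into a double sum over matrix coordinates. *)
Lemma factor_energy_pair i j x : i != j ->
  factor_energy [set i; j]%SET x = - dotv (x i *m weight_mx i j) (x j).
Proof.
move=> ij; congr (- _).
pose ki : {k : 'I_(nvar M) | k \in [set i; j]%SET} := Sub i (set21 i j).
pose kj : {k : 'I_(nvar M) | k \in [set i; j]%SET} := Sub j (set22 i j).
have kij : kj != ki by rewrite -val_eqE /= eq_sym.
have kP k : (k == ki) || (k == kj).
  by have := valP k; rewrite !inE -!val_eqE.
have outerE (m : multi_index (@vdim R M) [set i; j]%SET) :
    outer [set i; j]%SET x m = x i 0 (m ki) * x j 0 (m kj).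
  rewrite ffunE (bigD1 ki)//=; congr (_ * _).
  rewrite (big_pred1 kj)//= => k; have := kP k.
  by case: eqVneq => [->|] //=; rewrite eq_sym (negbTE kij).
rewrite /frobenius (eq_bigr _ (fun m _ => congr1 _ (outerE m))) /=.
(* Group the multi-indices by their entries at [i] and [j]; each group then gives one entry of
   [weight_mx i j]. *)
rewrite (partition_big (fun m : multi_index (@vdim R M) [set i; j]%SET =>
  (m ki : 'I_(vdim i), m kj : 'I_(vdim j))) xpredT) //=.
rewrite -(pair_bigA _ (fun a b => \sum_(m : multi_index (@vdim R M) [set i; j]%SET
    | (m ki, m kj) == (a, b))
   weight [set i; j]%SET m * (x i 0 (m ki) * x j 0 (m kj))))//=.
rewrite exchange_big; apply: eq_bigr => b _.
rewrite mxE mulr_suml; apply: eq_bigr => a _.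
rewrite mxE mulr_sumr mulr_suml; apply: eq_big => [m|m /eqP[-> ->]]; last first.
  by rewrite mulrCA mulrA.
apply/eqP/forallP => [[<- <-] k|mab].
  by case/orP: (kP k) => /eqP -> /=; rewrite !eqxx ?(negbTE ij) // eq_sym (negbTE ij).
have /andP[+ _] := mab ki; have /andP[_ +] := mab kj.
by rewrite /= !eqxx => /eqP/val_inj <- /eqP/val_inj <-.
Qed.

Lemma factor_energy_dfwith f j x z : j \notin f ->
  factor_energy f (dfwith x j z) = factor_energy f x.
Proof.
move=> jf; congr (- _); apply: eq_bigr => m _; rewrite !ffunE; congr (_ * _).
by apply: eq_bigr => k _; rewrite dfwithout//; apply: contraNneq jf => ->; exact: valP.
Qed.

(** A two-element factor through [j] is determined by its other endpoint, so factors through [j]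
    correspond bijectively to neighbours of [j]. *)
Lemma sum_factors_at (F : {set 'I_(nvar M)} -> R) j : pairwise_model M ->
  \sum_(f in factors M | j \in f) F f =
  \sum_(i | [set i; j]%SET \in factors M) F [set i; j]%SET.
Proof.
(* The default [j] is never returned on a factor containing [j], as removing [j] leaves a
   singleton. *)
move=> pw; pose other f := odflt j [pick i in (f :\ j)%SET].
have otherK f : (f \in factors M) && (j \in f) -> [set other f; j]%SET = f.
  case/andP => /pw/eqP fM jf; rewrite (cardsD1 j) jf eqSS in fM.
  have /cards1P[i fE] := fM; have -> : other f = i.
    by rewrite /other fE; case: pickP => /= [k|/(_ i)]; rewrite inE ?eqxx // => /eqP.
  by rewrite -fE finset.setUC finset.setD1K.
rewrite (reindex_onto (fun i => [set i; j]%SET) other)//=.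
apply: eq_bigl => i; rewrite set22 andbT.
case: (boolP (_ \in _)) => //= ijM; have ij : i != j.
  by have := pw _ ijM; rewrite cards2; case: eqP.
rewrite /other finset.setUC finset.setU1K; last by rewrite inE eq_sym.
by case: pickP => /= [k|/(_ i)]; rewrite inE ?eqxx // => /eqP.
Qed.

Lemma energy_dfwith j x z : pairwise_model M ->
  energy (dfwith x j z) =
  (\sum_(i | i != j) unary_energy (x i)
   + (\sum_(f in factors M | j \notin f) factor_energy f x)%:E
   + (reg z - (dotv z (preactivation j x))%:E))%E.
Proof.
move=> pw; rewrite /energy (bigD1 j)//= dfwithin.
rewrite (eq_bigr (fun i => unary_energy (x i))) => [|i ij]; last first.
  by rewrite dfwithout// eq_sym.
rewrite sumEFin (bigID (fun f => j \in f)) /= sum_factors_at//.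
rewrite (eq_bigr (fun i => - dotv z (x i *m weight_mx i j))) => [|i ijM]; last first.
  have ij : i != j by have := pw _ ijM; rewrite cards2; case: eqP.
  by rewrite factor_energy_pair// dfwithin dfwithout 1?eq_sym// dotvC.
rewrite [X in (_ + (_ + X)%:E)%E](eq_bigr (fun f => factor_energy f x)) => [|f /andP[_ jf]]; last first.
  by rewrite factor_energy_dfwith.
rewrite sumrN /preactivation dotvDr dotv_sumr /unary_energy dotvC.
rewrite opprD !EFinD [((- dotv z _)%:E + _)%E]addeC [X in (X + _)%E = _]addeC.
by rewrite [((- _)%:E + _)%E]addeC addeACA; congr (_ + _)%E; rewrite addeA.
Qed.
End Energy.

(** * Acyclicity and evaluation of the unrolled graph *)

Section UnrolledGraph.
Variables (R : realType) (M : factor_model R).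
Variables (N : nat) (pi : 'I_N -> 'I_(nvar M)).

Lemma feedforward_unroll : feedforward (unroll pi).
Proof.
(* Time stamps: inputs come at time 0 and update [k] at time [k.+1]. Arrows strictly increase them,
   which excludes cycles. *)
pose rank (v : node (unroll pi)) := if v is inr k then k.+1 else 0%N.
have arrowP u v : @arrow R (unroll pi) u v -> (rank u < rank v)%N.
  by case: v => //= k /andP[+ _]; case: u => //= l /andP[].
split=> [u v /arrowP uv|u [i|k]] //; apply/negP => /connectP[p vp uE].
suff : (rank v <= rank u)%N by rewrite leqNgt uv.
rewrite {}uE {u uv}; elim: p v vp => //= w p IH v /andP[/arrowP/ltnW vw /IH].
exact: leq_trans.
Qed.

(** The node is the last update of block [i] before [k], or the input node of [i] if there is
    none. *)
Lemma current_unique i (k : 'I_N) :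
  exists u, (fun v => current pi v k && (block_of pi v == i)) =1 pred1 u.
Proof.
case: (pickP (fun l : 'I_N => (l < k)%N && (pi l == i))) => [l0 l0P|noupd].
  case: (@arg_maxnP _ l0 (fun l : 'I_N => (l < k)%N && (pi l == i)) val l0P).
  move=> l /andP[lk /eqP li] /= lmax.
  have lcur : [forall l' : 'I_N, (l < l' < k)%N ==> (pi l' != i)].
    apply/forallP => l'; apply/implyP => /andP[ll' l'k]; apply/negP => l'i.
    by have := lmax l'; rewrite /= l'k l'i leqNgt ll' => /(_ isT).
  exists (inr l) => -[i'|l'] /=.
    apply/andP => -[/forallP/(_ l)]; rewrite lk /= => + /eqP i'i.
    by rewrite i'i li eqxx.
  apply/andP/eqP => [[/andP[l'k /forallP l'cur] /eqP l'i]|[->]]; last first.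
    by rewrite li lk.
  have l'l : (l' <= l)%N by apply: lmax; rewrite l'k l'i eqxx.
  congr inr; apply/val_inj/eqP; rewrite /= eqn_leq l'l leqNgt.
  by apply/negP => ll'; have := l'cur l; rewrite ll' lk li l'i eqxx.
exists (inl i) => -[i'|l'] /=; last first.
  by apply/negP => /andP[/andP[l'k _] l'i]; have := noupd l'; rewrite l'k l'i.
apply/andP/eqP => [[_ /eqP ->]|[->]] //; split=> //.
apply/forallP => l; apply/implyP => lk; apply/negP => li.
by have := noupd l; rewrite lk li.
Qed.

Lemma run_val_current (X : nat -> state M) u (k : 'I_N) :
  (forall (l : 'I_N) i, i != pi l -> X l.+1 i = X l i) ->
  current pi u k -> run_val pi X u = X k (block_of pi u).
Proof.
move=> Xfix.
(* A block keeps its value over any time interval in which it is not updated; states after time [N]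
   are unconstrained, hence the bound. *)
have XE i m n : (m <= n <= N)%N ->
    (forall l : 'I_N, (m <= l < n)%N -> pi l != i) -> X n i = X m i.
  case/andP => mn; elim: n mn => [|n IH]; first by rewrite leqn0 => /eqP ->.
  rewrite leq_eqVlt => /orP[/eqP -> //|]; rewrite ltnS => mn nN upd.
  rewrite (Xfix (Ordinal nN)) ?IH ?(ltnW nN)// 1?eq_sym.
    by move=> l /andP[ml ln]; apply: upd; rewrite ml ltnW.
  by rewrite upd//= mn leqnn.
case: u => [i|l] /=.
  move=> /forallP upd; rewrite (XE i 0%N k)//; first exact: ltnW.
  by move=> l /= lk; have := upd l; rewrite lk.
move=> /andP[lk /forallP upd]; rewrite (XE (pi l) l.+1 k)// ?lk ?(ltnW (ltn_ord k))//.
by move=> l' ll'; have := upd l'; rewrite ll'.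
Qed.

(** Stated from the two update equations alone, so as to serve both for feasible descent runs and
    for the explicit run from an arbitrary initial state. *)
Lemma forward_eval_run_val (X : nat -> state M) :
  (forall (l : 'I_N) i, i != pi l -> X l.+1 i = X l i) ->
  (forall k : 'I_N, X k.+1 (pi k) = activation (preactivation (pi k) (X k))) ->
  forward_eval (run_val pi X).
Proof.
move=> Xfix Xact [//|k] _; rewrite [LHS]Xact; congr (activation (bias _ + _)).
(* Grouping predecessors by block leaves exactly one current node for each neighbour of [pi k]. *)
rewrite (partition_big (block_of pi)
  (fun i => [set i; pi k]%SET \in factors M)) /= => [|u /andP[]//].
apply: eq_bigr => i ik; have [u uP] := current_unique i k.
have /andP[ucur /eqP ui] : current pi u k && (block_of pi u == i).
  by rewrite uP /= eqxx.
rewrite (big_pred1 u) => [|v]; last first.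
  rewrite -uP andbAC; case: eqVneq => [->|_]; rewrite ?andbF//.
  by rewrite ik andbT.
by rewrite (run_val_current Xfix ucur) ui.
Qed.

(** Predecessors of an update are inputs or earlier updates, so strong induction on the update index
    applies. *)
Lemma forward_eval_inj (h g : forall v : node (unroll pi), 'rV[R]_(ndim v)) :
  (forall i : 'I_(nvar M), h (inl i) = g (inl i)) ->
  forward_eval h -> forward_eval g -> forall v, h v = g v.
Proof.
move=> hg0 hE gE; suff IH n (k : 'I_N) : (k < n)%N -> h (inr k) = g (inr k).
  by case=> [i|k]; [exact: hg0 | apply: (IH k.+1)].
elim: n k => // n IH k; rewrite ltnS => kn.
rewrite (hE (inr k) isT) (gE (inr k) isT).
do 2 apply: congr1; apply: eq_bigr => u /andP[uk _].
apply: (congr1 (mulmx^~ _)); case: u uk => [i _|l /andP[lk _]]; first exact: hg0.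
by apply: IH; exact: leq_trans lk kn.
Qed.

End UnrolledGraph.

(** * Block updates as activations *)

Section BlockUpdate.
Variables (R : realType) (M : factor_model R).
Hypothesis pw : pairwise_model M.
Hypothesis regNy : forall i (z : 'rV[R]_(vdim i)), @reg R M i z != -oo%E.
Hypothesis sreg : forall i, smooth_conj (@reg R M i).
Implicit Types (x : state M) (i j : 'I_(nvar M)).

Lemma oppe_conj_objective j x (z : 'rV[R]_(vdim j)) :
  (reg z - (dotv z (preactivation j x))%:E =
   - ((dotv z (preactivation j x))%:E - reg z))%E.
Proof. by rewrite oppeB 1?addeC// fin_num_adde_defr. Qed.

Lemma reg_activation_fin j t : reg (@activation R M j t) \is a fin_num.
Proof.
exact: argmax_fin_num (@sreg j) (argmax_grad_conj t (@sreg j)).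
Qed.

(** Adding a common term preserves inequalities even when that term is infinite, so the other blocks
    may be arbitrary. *)
Lemma argmin_energy_activation j x :
  argmin (fun z => energy (dfwith x j z)) (activation (preactivation j x)).
Proof.
move=> z; rewrite !energy_dfwith// leeD2l// !oppe_conj_objective leeN2.
exact: argmax_grad_conj.
Qed.

(** Here the common term has to be cancelled, which requires it to be finite: this is where the
    other blocks must lie in their domains. *)
Lemma argmin_energy_unique j x z :
  (forall i, i != j -> (reg (x i) < +oo)%E) ->
  argmin (fun z => energy (dfwith x j z)) z -> z = activation (preactivation j x).
Proof.
move=> xfin zmin; apply/esym/grad_conj_argmax => // y.
have := zmin y; rewrite !energy_dfwith// leeD2lE.
  by rewrite !oppe_conj_objective leeN2.
rewrite fin_numD andbT; apply/sum_fin_numP => i _ ij.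
rewrite /unary_energy fin_numD /= fin_numE regNy lt_eqF//.
exact: xfin.
Qed.

Lemma bcd_step_activation j x x' :
  (forall i, i != j -> x' i = x i) ->
  x' j = activation (preactivation j x) -> bcd_step j x x'.
Proof. by move=> xE x'j; split; rewrite ?x'j//; exact: argmin_energy_activation. Qed.

Variables (N : nat) (pi : 'I_N -> 'I_(nvar M)).

(** By induction, before each update every block other than the one to be updated has a finite
    regularizer: a block just updated is an activation, where [reg] is finite, and the others are
    unchanged. *)
Lemma bcd_run_activation (X : nat -> state M) :
  feasible pi (X 0%N) -> bcd_run pi X ->
  forall k : 'I_N, X k.+1 (pi k) = activation (preactivation (pi k) (X k)).
Proof.
move=> X0 run; suff fin n (k : 'I_N) : k = n :> nat ->
    forall i, i != pi k -> (reg (X k i) < +oo)%E.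
  by move=> k; have [_ /argmin_energy_unique-> //] := run k; exact: fin.
elim: n k => [|n IH] k kn i ik; rewrite kn.
  (* Only the block of the first update escapes [feasible], and [i] is not that block. *)
  apply: X0 => l l0; rewrite eq_sym (_ : l = k)//.
  by apply/val_inj; rewrite /= l0 kn.
have nN : (n < N)%N by rewrite ltnW// -kn.
have [Xfix Xmin] := run (Ordinal nN); have fixed := IH (Ordinal nN) erefl.
have [->|ipi] := eqVneq i (pi (Ordinal nN)).
  rewrite (argmin_energy_unique fixed Xmin).
  by rewrite ltey_eq reg_activation_fin.
rewrite Xfix//; exact: fixed.
Qed.

(** [insub] turns the time into an update index; from time [N] on the state is constant. *)
Fixpoint unrolled_run (x0 : state M) (k : nat) : state M :=
  if k is k'.+1 then
    let x := unrolled_run x0 k' in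
    if insub k' is Some l
    then dfwith x (pi l) (activation (preactivation (pi l) x)) else x
  else x0.

Lemma bcd_run_unrolled_run x0 :
  bcd_run pi (unrolled_run x0).
Proof.
move=> k /=; rewrite valK; apply: bcd_step_activation.
  by move=> i ik; rewrite dfwithout// eq_sym.
by rewrite dfwithin.
Qed.

Lemma unrolled_run_activation x0 (k : 'I_N) :
  unrolled_run x0 k.+1 (pi k) =
  activation (preactivation (pi k) (unrolled_run x0 k)).
Proof. by rewrite /= valK dfwithin. Qed.

End BlockUpdate.

Theorem lemma1 (R : realType) (M : factor_model R)
    (N : nat) (pi : 'I_N -> 'I_(nvar M)) :
  pairwise_model M ->
  (forall i : 'I_(nvar M), strictly_convex (@reg R M i)) ->
  (forall i : 'I_(nvar M), smooth_conj (@reg R M i)) ->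
  [/\ feedforward (unroll pi),
      (forall X : nat -> state M, feasible pi (X 0%N) -> bcd_run pi X ->
         (forall k : 'I_N,
            X k.+1 (pi k) = activation (preactivation (pi k) (X k))) /\
         forward_eval (run_val pi X))
    & (forall x0 : state M, exists X : nat -> state M,
         [/\ X 0%N = x0,
             bcd_run pi X
           & (forall h : forall v : node (unroll pi), 'rV[R]_(ndim v),
                (forall i : 'I_(nvar M), h (inl i) = x0 i) ->
                (forward_eval h <->
                 forall v : node (unroll pi), h v = run_val pi X v))])].
Proof.
move=> pw /(_ _)/proj1 regNy sreg; split; first exact: feedforward_unroll.
- move=> X X0 run; have Xact := bcd_run_activation pw regNy sreg X0 run.
  by split=> //; apply: forward_eval_run_val => // l; have [] := run l.
- move=> x0; pose X := unrolled_run pi x0.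
  have run : bcd_run pi X := bcd_run_unrolled_run pw sreg pi x0.
  have XE : forward_eval (run_val pi X).
    apply: forward_eval_run_val; first by move=> l; have [] := run l.
    exact: unrolled_run_activation.
  exists X; split=> [//|//|h h0]; split=> [hE|hX v vN].
    exact: (forward_eval_inj h0 hE XE).
  (* The evaluation equation of [run_val pi X] is carried over to [h] node by node. *)
  rewrite hX (XE v vN); do 2 apply: congr1.
  by apply: eq_bigr => u _; rewrite hX.
Qed.
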